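(* Consider the differential-algebraic power system model described in the context, for which $x_{di}''=x_{qi}''$ for every generator $i\in\mathcal V_t$ (so that the generator internal voltage $E_i\angle\eta_i$ is a function of the state $\bm x_{gi}$ only and is linked to the terminal bus by the impedance $r_{ai}+\mathrm j x_{di}''$). Let $(\bm x(t),\bm y(t))$ be a trajectory of this system along which the voltage magnitudes of all buses are non-zero. Then the trajectory encounters the impasse surface at time $t$ (i.e. $\det \bm J_{\mathrm{alg}}(\bm x(t),\bm y(t))=0$) only if $$\sigma_{\min}(\bm Y_1(t))\le \max_{i\in\mathcal V_L}\Big|\big(1-\tfrac{\alpha_i}{2}\big)G_{si}^{\mathrm{eq}}(t)+\mathrm j\big(1-\tfrac{\beta_i}{2}\big)B_{si}^{\mathrm{eq}}(t)\Big|,$$ where $\sigma_{\min}$ denotes the minimum singular value and $$\bm Y_1(t)=\bm Y_{\mathrm{bus}}+\bm Y_{\mathrm{gen}}+\bm Y_{\mathrm{mot}}^{\mathrm{eq}}(t)+\tfrac12\bm\alpha\,\bm G_{\mathrm{stat}}^{\mathrm{eq}}(t)+\mathrm j\,\tfrac12\bm\beta\,\bm B_{\mathrm{stat}}^{\mathrm{eq}}(t)\in\mathbb C^{n\times n}.$$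
   Context: Notation: $\mathrm j=\sqrt{-1}$; $j$ is an index; $\mathrm{diag}\{x_i\}$ is a diagonal matrix. Buses. Let $1\le g\le n$, $\mathcal V_t=\{1,\dots,g\}$ (generator terminal buses), $\mathcal V_L=\{1,\dots,n\}$ (buses of the power network), $\mathcal V_G=\{n+1,\dots,n+g\}$ (generator internal buses); bus $n+i$ is the internal bus of the generator at terminal bus $i\in\mathcal V_t$. Each bus $i\in\mathcal V_L\cup\mathcal V_G$ has a phase angle $\theta_i$ and a voltage magnitude $V_i\ge 0$; $\theta_{ij}=\theta_i-\theta_j$. Generators. For $i\in\mathcal V_t$ the generator has state $\bm x_{gi}$ obeying $\dot{\bm x}_{gi}=\bm f_{gi}(\bm x_{gi},\theta_i,V_i)$ for a given function $\bm f_{gi}$, armature resistance $r_{ai}$, $d$- and $q$-axis subtransient reactances $x_{di}'',x_{qi}''$. When $x_{di}''=x_{qi}''$ its internal voltage magnitude and angle are given functions of the state only: $V_{n+i}=E_i(\bm x_{gi})$, $\theta_{n+i}=\eta_i(\bm x_{gi})$. Set $y_i^{gs}=(r_{ai}+\mathrm j x_{di}'')^{-1}$. Loads. At bus $i\in\mathcal V_L$ the static load is $P_{si}(V_i)=P_{si}^0V_i^{\alpha_i}$, $Q_{si}(V_i)=Q_{si}^0V_i^{\beta_i}$ with real constants $P_{si}^0,Q_{si}^0,\alpha_i,\beta_i$. The induction motor at bus $i$ has state $\bm x_{mi}=(\varsigma_i,e_{di}',e_{qi}')$ ($\varsigma_i$ the slip) obeying $\dot{\bm x}_{mi}=\bm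 f_{mi}(\bm x_{mi},\theta_i,V_i)$ for a given function $\bm f_{mi}$, and equivalent admittance $$Y_{mi}^{\mathrm{eq}}(\varsigma_i)=\Big(r_{Si}+\mathrm jx_{Si}+\frac{\mathrm jx_{Mi}(r_{Ri}/\varsigma_i+\mathrm jx_{Ri})}{r_{Ri}/\varsigma_i+\mathrm j(x_{Ri}+x_{Mi})}\Big)^{-1}=G_{mi}^{\mathrm{eq}}+\mathrm jB_{mi}^{\mathrm{eq}}$$ with real constants $r_{Si},x_{Si},r_{Ri},x_{Ri},x_{Mi}$ ($Y_{mi}^{\mathrm{eq}}=0$ if there is no motor at bus $i$); it consumes $P_{mi}=G_{mi}^{\mathrm{eq}}(\varsigma_i)V_i^2$, $Q_{mi}=-B_{mi}^{\mathrm{eq}}(\varsigma_i)V_i^2$. Network. Line $(i,j)$ between buses of $\mathcal V_L$ has admittance $y_{ij}=y_{ji}\in\mathbb C$, with $y_{ij}=0$ if $i,j$ are not directly connected; the network on $\mathcal V_L$ is connected; $y_{i0}\in\mathbb C$ is the shunt admittance at bus $i$. $\bm Y_{\mathrm{bus}}=[Y_{ij}]\in\mathbb C^{n\times n}$ has $Y_{ii}=y_{i0}+\sum_{j\ne i}y_{ij}$ and $Y_{ij}=-y_{ij}$ for $i\ne j$. $\bm Y_{\mathrm{gen}}=\mathrm{diag}\{Y_{gi}\}\in\mathbb C^{n\times n}$ with $Y_{gi}=y_i^{gs}$ for $i\in\mathcal V_t$ and $Y_{gi}=0$ for $i\in\mathcal V_L\setminus\mathcal V_t$. The augmented admittance matrix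 is $$\widetilde{\bm Y}=[\widetilde Y_{ij}]=\begin{bmatrix}\bm Y_{\mathrm{bus}}+\bm Y_{\mathrm{gen}}&\bm Y_{LG}\\ \bm Y_{LG}^T&\bm Y_{GG}\end{bmatrix}\in\mathbb C^{(n+g)\times(n+g)},$$ where $\bm Y_{GG}=\mathrm{diag}\{y_i^{gs}\}\in\mathbb C^{g\times g}$, and $\bm Y_{LG}\in\mathbb C^{n\times g}$ has $(i,i)$-entry $-y_i^{gs}$ for $i\in\mathcal V_t$ and all other entries $0$. Write $\widetilde Y_{ij}=\widetilde G_{ij}+\mathrm j\widetilde B_{ij}$. For $i\ne j$ let $\varphi_{ij}$ be the phase shift with $\widetilde B_{ij}=|\widetilde Y_{ij}|\cos\varphi_{ij}$, $\widetilde G_{ij}=-|\widetilde Y_{ij}|\sin\varphi_{ij}$ (i.e. $\varphi_{ij}=-\tan^{-1}(\widetilde G_{ij}/\widetilde B_{ij})$ when $\widetilde B_{ij}>0$), and $\varphi_{ij}=0$ if $\widetilde Y_{ij}=0$. Power flow equations, for each $i\in\mathcal V_L$: $$0=g_{pi}=V_i^2\widetilde G_{ii}+\sum_{j=1,j\ne i}^{n+g}V_iV_j|\widetilde Y_{ij}|\sin(\theta_{ij}-\varphi_{ij})+P_{si}(V_i)+P_{mi}(\varsigma_i,V_i),$$ $$0=g_{qi}=-V_i^2\widetilde B_{ii}-\sum_{j=1,j\ne i}^{n+g}V_iV_j|\widetilde Y_{ij}|\cos(\theta_{ij}-\varphi_{ij})+Q_{si}(V_i)+Q_{mi}(\varsigma_i,V_i).$$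 DAE system: $\dot{\bm x}=\bm f(\bm x,\bm y)$, $\bm 0=\bm g(\bm x,\bm y)$, where $\bm x$ collects all $\bm x_{gi}$ and $\bm x_{mi}$, $\bm y=(\theta_1,\dots,\theta_n,V_1,\dots,V_n)$, $\bm f$ collects the $\bm f_{gi},\bm f_{mi}$, and $\bm g=(g_{p1},\dots,g_{pn},g_{q1},\dots,g_{qn})$, with $\theta_{n+i},V_{n+i}$ substituted by $\eta_i(\bm x_{gi}),E_i(\bm x_{gi})$. A trajectory $(\bm x(t),\bm y(t))$ is a solution of this system; in particular $\bm g(\bm x(t),\bm y(t))=\bm 0$ at every $t$ considered. Algebraic Jacobian: $\bm J_{\mathrm{alg}}(\bm x,\bm y)=\partial\bm g(\bm x,\bm y)/\partial\bm y\in\mathbb R^{2n\times2n}$ ($\bm x$ held fixed). Impasse surface: $\{(\bm x,\bm y):\det\bm J_{\mathrm{alg}}(\bm x,\bm y)=0\}$. Equivalent load admittances along a trajectory: $G_{si}^{\mathrm{eq}}(t)=P_{si}(V_i(t))/V_i(t)^2$, $B_{si}^{\mathrm{eq}}(t)=-Q_{si}(V_i(t))/V_i(t)^2$; $\bm Y_{\mathrm{mot}}^{\mathrm{eq}}(t)=\mathrm{diag}\{Y_{mi}^{\mathrm{eq}}(\varsigma_i(t))\}$, $\bm G_{\mathrm{stat}}^{\mathrm{eq}}(t)=\mathrm{diag}\{G_{si}^{\mathrm{eq}}(t)\}$, $\bm B_{\mathrm{stat}}^{\mathrm{eq}}(t)=\mathrm{diag}\{B_{si}^{\mathrm{eq}}(t)\}$,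 $\bm\alpha=\mathrm{diag}\{\alpha_i\}$, $\bm\beta=\mathrm{diag}\{\beta_i\}$, all $n\times n$. *)

(* Defs.v *)
From HB Require Import structures.
From mathcomp Require Import all_boot all_order all_algebra.
From mathcomp Require Import all_classical all_reals all_analysis.
From mathcomp Require Import complex.

Set Implicit Arguments.
Unset Strict Implicit.
Unset Printing Implicit Defensive.

Import Order.TTheory GRing.Theory Num.Theory.
Import numFieldNormedType.Exports.

Local Open Scope classical_set_scope.
Local Open Scope ring_scope.
Local Open Scope complex_scope.

Section SingularValues.
Import ComplexField.
Local Open Scope sesquilinear_scope.

Definition singular_value (R : realType) (n : nat) (A : 'M[R[i]]_n) (s : R) :=
  0 <= s /\ eigenvalue (A ^t* *m A) (s ^+ 2)%:C.

(* For n > 0 the set of singular values is finite and nonempty, so that the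
   infimum is a minimum. *)
Definition sigma_min (R : realType) (n : nat) (A : 'M[R[i]]_n) : R :=
  inf [set s | singular_value A s].

End SingularValues.

Definition cmod (R : realType) (z : R[i]) : R := ComplexField.Normc.normc z.

(* The arguments of [gen_field] are the state, the angle and the magnitude of the
   terminal voltage.  The internal voltage depends on the state only, which is
   appropriate when [reac_d] and [reac_q] coincide. *)
Record generator (R : realType) := Generator {
  gen_dim : nat;
  gen_field : 'rV[R]_gen_dim -> R -> R -> 'rV[R]_gen_dim;
  arm_res : R;
  reac_d : R;
  reac_q : R;
  int_mag : 'rV[R]_gen_dim -> R;
  int_ang : 'rV[R]_gen_dim -> R
}.

Definition source_adm (R : realType) (G : generator R) : R[i] :=
  (arm_res G +i* reac_d G)^-1.

(* The motor state is (slip, e'_d, e'_q). *)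
Record motor (R : realType) := Motor {
  motor_field : 'rV[R]_3 -> R -> R -> 'rV[R]_3;
  r_S : R;
  x_S : R;
  r_R : R;
  x_R : R;
  x_M : R
}.

Definition slip (R : realType) (xm : 'rV[R]_3) : R := xm ord0 ord0.

(* At s = 0, where the formula is undefined, the value is an artefact of total
   division. *)
Definition motor_adm_of (R : realType) (M : motor R) (s : R) : R[i] :=
  (r_S M +i* x_S M
   + ((0 +i* x_M M) * (r_R M / s +i* x_R M))
     / (r_R M / s +i* (x_R M + x_M M)))^-1.

Record load (R : realType) := Load {
  P0 : R;
  Q0 : R;
  expP : R;
  expQ : R;
  motor_at : option (motor R)
}.

Definition motor_adm (R : realType) (L : load R) (s : R) : R[i] :=
  if motor_at L is Some M then motor_adm_of M s else 0.

(* Buses 1..n are ['I_n]; the generators are ['I_g], the k-th one being attached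
   to the k-th bus; all n + g buses (network buses, then internal buses) are
   ['I_(n + g)].  The diagonal values [line_adm i i] are never used. *)
Record power_system (R : realType) (n g : nat) := PowerSystem {
  gen : 'I_g -> generator R;
  ld : 'I_n -> load R;
  line_adm : 'I_n -> 'I_n -> R[i];
  shunt_adm : 'I_n -> R[i]
}.

Section Model.
Context {R : realType} {n g : nat}.
Variable S : power_system R n g.

Definition lines_symmetric : Prop :=
  forall i j, line_adm S i j = line_adm S j i.

Definition is_line : rel 'I_n :=
  fun i j => (i != j) && (line_adm S i j != 0).

Definition network_connected : Prop := forall i j, connect is_line i j.

Definition Ybus : 'M[R[i]]_n :=
  \matrix_(i, j)
    if i == j then shunt_adm S i + \sum_(k < n | k != i) line_adm S i k
    else - line_adm S i j.

Definition Ygen : 'M[R[i]]_n :=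
  diag_mx (\row_(i < n)
    if (insub (val i) : option 'I_g) is Some k then source_adm (gen S k)
    else 0).

Definition YLG : 'M[R[i]]_(n, g) :=
  \matrix_(i, k) if val i == val k then - source_adm (gen S k) else 0.

Definition YGG : 'M[R[i]]_g := diag_mx (\row_(k < g) source_adm (gen S k)).

Definition Yaug : 'M[R[i]]_(n + g) := block_mx (Ybus + Ygen) YLG YLG^T YGG.

Definition Gaug (i j : 'I_(n + g)) : R := complex.Re (Yaug i j).
Definition Baug (i j : 'I_(n + g)) : R := complex.Im (Yaug i j).

(* The phase shifts are determined modulo 2 pi only. *)
Definition phase_shifts (phi : 'I_(n + g) -> 'I_(n + g) -> R) : Prop :=
  forall i j, i != j ->
    [/\ Baug i j = cmod (Yaug i j) * cos (phi i j),
        Gaug i j = - (cmod (Yaug i j) * sin (phi i j))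
      & Yaug i j = 0 -> phi i j = 0].

(* [xm i] is a dummy when bus i carries no motor. *)
Record state := State {
  xg : forall k : 'I_g, 'rV[R]_(gen_dim (gen S k));
  xm : 'I_n -> 'rV[R]_3
}.

(* y = (theta_1, ..., theta_n, V_1, ..., V_n) *)
Definition th (y : 'rV[R]_(n + n)) (i : 'I_n) : R := y ord0 (lshift n i).
Definition vm (y : 'rV[R]_(n + n)) (i : 'I_n) : R := y ord0 (rshift n i).

Definition bus_angle (x : state) (y : 'rV[R]_(n + n)) (b : 'I_(n + g)) : R :=
  match fintype.split b with
  | inl i => th y i
  | inr k => int_ang (xg x k)
  end.

Definition bus_mag (x : state) (y : 'rV[R]_(n + n)) (b : 'I_(n + g)) : R :=
  match fintype.split b with
  | inl i => vm y i
  | inr k => int_mag (xg x k)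
  end.

Definition Pstat (i : 'I_n) (V : R) : R := P0 (ld S i) * V `^ expP (ld S i).
Definition Qstat (i : 'I_n) (V : R) : R := Q0 (ld S i) * V `^ expQ (ld S i).

Definition Pmot (i : 'I_n) (s V : R) : R :=
  complex.Re (motor_adm (ld S i) s) * V ^+ 2.
Definition Qmot (i : 'I_n) (s V : R) : R :=
  - complex.Im (motor_adm (ld S i) s) * V ^+ 2.

Section Equations.
Variable phi : 'I_(n + g) -> 'I_(n + g) -> R.

Definition g_p (x : state) (y : 'rV[R]_(n + n)) (i : 'I_n) : R :=
  let b := lshift g i in
  vm y i ^+ 2 * Gaug b b
  + \sum_(j < n + g | j != b)
      vm y i * bus_mag x y j * cmod (Yaug b j)
      * sin (th y i - bus_angle x y j - phi b j)
  + Pstat i (vm y i) + Pmot i (slip (xm x i)) (vm y i).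

Definition g_q (x : state) (y : 'rV[R]_(n + n)) (i : 'I_n) : R :=
  let b := lshift g i in
  - (vm y i ^+ 2 * Baug b b)
  - \sum_(j < n + g | j != b)
      vm y i * bus_mag x y j * cmod (Yaug b j)
      * cos (th y i - bus_angle x y j - phi b j)
  + Qstat i (vm y i) + Qmot i (slip (xm x i)) (vm y i).

Definition g_alg (x : state) (y : 'rV[R]_(n + n)) : 'rV[R]_(n + n) :=
  row_mx (\row_i g_p x y i) (\row_i g_q x y i).

Definition J_alg (x : state) (y : 'rV[R]_(n + n)) : 'M[R]_(n + n) :=
  \matrix_(k, l) 'D_(delta_mx ord0 l) (fun z => g_alg x z ord0 k) y.

Definition impasse_surface : set (state * 'rV[R]_(n + n)) :=
  [set p | \det (J_alg p.1 p.2) = 0].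

(* One-sided at the end points of T: at an impasse point a trajectory may be
   unable to continue. *)
Definition derivative_within (T : set R) (d : nat)
    (u : R -> 'rV[R]_d) (t : R) (v : 'rV[R]_d) : Prop :=
  (fun s => (s - t)^-1 *: (u s - u t)) @ within T t^' --> v.

Record trajectory (le_gn : (g <= n)%N) (T : set R)
    (x : R -> state) (y : R -> 'rV[R]_(n + n)) : Prop := Trajectory {
  traj_interval : is_interval T;
  traj_nondegenerate : exists s t, [/\ T s, T t & s < t];
  traj_gen : forall t, T t -> forall k : 'I_g,
    let i := widen_ord le_gn k in
    derivative_within T (fun s => xg (x s) k) t
      (gen_field (xg (x t) k) (th (y t) i) (vm (y t) i));
  traj_motor : forall t, T t -> forall (i : 'I_n) (M : motor R),
    motor_at (ld S i) = Some M ->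
    derivative_within T (fun s => xm (x s) i) t
      (motor_field M (xm (x t) i) (th (y t) i) (vm (y t) i));
  traj_alg : forall t, T t -> g_alg (x t) (y t) = 0
}.

End Equations.

Definition Gstat_eq (y : 'rV[R]_(n + n)) (i : 'I_n) : R :=
  Pstat i (vm y i) / vm y i ^+ 2.
Definition Bstat_eq (y : 'rV[R]_(n + n)) (i : 'I_n) : R :=
  - Qstat i (vm y i) / vm y i ^+ 2.

Definition Ymot_eq (x : state) : 'M[R[i]]_n :=
  diag_mx (\row_i motor_adm (ld S i) (slip (xm x i))).
Definition Gstat_mx (y : 'rV[R]_(n + n)) : 'M[R[i]]_n :=
  diag_mx (\row_i (Gstat_eq y i)%:C).
Definition Bstat_mx (y : 'rV[R]_(n + n)) : 'M[R[i]]_n :=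
  diag_mx (\row_i (Bstat_eq y i)%:C).
Definition alpha_mx : 'M[R[i]]_n := diag_mx (\row_i (expP (ld S i))%:C).
Definition beta_mx : 'M[R[i]]_n := diag_mx (\row_i (expQ (ld S i))%:C).

Definition Y1 (x : state) (y : 'rV[R]_(n + n)) : 'M[R[i]]_n :=
  Ybus + Ygen + Ymot_eq x
  + 2^-1 *: (alpha_mx *m Gstat_mx y)
  + (0 +i* 2^-1) *: (beta_mx *m Bstat_mx y).

(* The moduli are nonnegative, so starting the maximum from 0 is harmless. *)
Definition load_bound (y : 'rV[R]_(n + n)) : R :=
  \big[Num.max/0]_(i < n)
    cmod ((1 - expP (ld S i) / 2) * Gstat_eq y i
          +i* ((1 - expQ (ld S i) / 2) * Bstat_eq y i)).

End Model.

(* Main.v *)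
Require Import Defs.
From mathcomp Require Import all_boot all_order all_algebra.
From mathcomp Require Import all_classical all_reals all_analysis.
From mathcomp Require Import complex ring.

Set Implicit Arguments.
Unset Strict Implicit.
Unset Printing Implicit Defensive.

Import Order.TTheory GRing.Theory Num.Theory.
Local Open Scope classical_set_scope.
Local Open Scope ring_scope.
Local Open Scope complex_scope.

(** The power flow equations at bus i are the real and imaginary parts of one
    complex equation: the apparent power v_i conj(I_i) injected into the
    network, plus the static load P_i + j Q_i, plus conj(Y_mi) V_i^2 for the
    motor, vanishes.  Here v_i = V_i e^(j theta_i) is the voltage phasor and
    I = Ytilde v the injected current ([power_mismatchE]).

    If the algebraic Jacobian is singular, some nonzero real direction
    (dtheta, dV) annihilates the linearization of all these equations
    ([impasse_direction]).  The internal generator voltages depend on the state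
    alone, so they are not varied, and the current variation is
    dI = (Ybus + Ygen) z, where z_i = (dV_i + j V_i dtheta_i) e^(j theta_i) is
    the phasor variation.  Write z_i = v_i w_i with w_i = dV_i/V_i + j dtheta_i.
    Using the power balance to remove I_i from the linearized equation, and
    dV_i/V_i = (w_i + conj w_i)/2 to express everything through w_i, the terms
    in w_i assemble into the matrix Y1, and those in conj w_i remain:

      (Y1 z)_i = v_i conj(w_i) c_i,
      c_i = (1 - alpha_i/2) G_si + j (1 - beta_i/2) B_si.

    Hence |(Y1 z)_i| = |c_i| |z_i| for every i ([Y1_phasor_variation]).  As the
    voltages do not vanish, z is nonzero ([phasor_variation_neq0]), and a matrix
    which sends a nonzero z to a vector bounded entrywise by c |z| has a
    singular value at most c ([sigma_min_le]), by the spectral theorem applied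
    to its Gram matrix. *)

(** * The smallest singular value *)

Section SmallestSingularValue.
Local Open Scope sesquilinear_scope.
Import ComplexField.
Variables (R : realType) (n : nat).
Implicit Types (A : 'M[R[i]]_n) (z : 'cV[R[i]]_n).

Lemma sum_sqr_norm_mx z :
  \sum_i `|z i ord0| ^+ 2 = (z ^t* *m z) ord0 ord0.
Proof.
rewrite mxE; apply: eq_bigr => i _.
by rewrite !mxE normCK mulrC.
Qed.

Lemma sum_sqr_norm_unitary (P : 'M[R[i]]_n) z : P \is unitarymx ->
  \sum_i `|(P *m z) i ord0| ^+ 2 = \sum_i `|z i ord0| ^+ 2.
Proof.
move=> Pu; rewrite !sum_sqr_norm_mx trmx_mul map_mxM /= mulmxA.
have PP' : P^t* *m P = 1%:M.
  by rewrite -(invmx_unitary Pu) mulVmx // unitarymx_unit.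
by rewrite -[_ *m _ *m P]mulmxA PP' mulmx1.
Qed.

Lemma gram_hermitian A : A ^t* *m A \is hermsymmx.
Proof.
apply/is_hermitianmxP; rewrite expr0 scale1r.
by rewrite trmx_mul map_mxM /= trmxCK.
Qed.

(** Diagonalizing the Gram matrix A^* A in a unitary basis turns the squared
    norm of A z into a weighted sum of squared coordinates of z. *)
Lemma gram_spectral_decomp A z :
  \sum_i `|(A *m z) i ord0| ^+ 2 =
  \sum_k spectral_diag (A ^t* *m A) ord0 k
         * `|(spectralmx (A ^t* *m A) *m z) k ord0| ^+ 2.
Proof.
set H := A ^t* *m A; set P := spectralmx H; set d := spectral_diag H.
have /hermitian_normalmx/orthomx_spectralP HE := gram_hermitian A.
have -> : \sum_i `|(A *m z) i ord0| ^+ 2 = (z ^t* *m H *m z) ord0 ord0.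
  by rewrite sum_sqr_norm_mx trmx_mul map_mxM /= /H !mulmxA.
rewrite -/H -/P -/d in HE; rewrite HE invmx_unitary ?spectral_unitarymx //.
have -> : z ^t* *m (P ^t* *m diag_mx d *m P) *m z
    = (P *m z) ^t* *m (diag_mx d *m (P *m z)).
  by rewrite trmx_mul map_mxM /= !mulmxA.
rewrite mxE; apply: eq_bigr => k _.
by rewrite mul_diag_mx !mxE normCK; ring.
Qed.

(** Evaluated at the k-th vector of the unitary eigenbasis, the decomposition
    above shows that the k-th weight is itself a squared norm. *)
Lemma gram_diag_ge0 A k : 0 <= spectral_diag (A ^t* *m A) ord0 k.
Proof.
set P := spectralmx (A ^t* *m A).
have := gram_spectral_decomp A (P ^t* *m delta_mx k ord0).
have /unitarymxP PP : P \is unitarymx by exact: spectral_unitarymx.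
rewrite -/P [P *m (_ *m _)]mulmxA PP mul1mx.
rewrite [X in _ = X -> _](bigD1 k) //= [X in _ = _ + X -> _]big1 ?addr0; last first.
  by move=> j jk; rewrite [delta_mx _ _ _ _]mxE (negPf jk) normr0 expr0n mulr0.
rewrite [delta_mx _ _ _ ord0]mxE !eqxx normr1 expr1n mulr1 => <-.
by apply: sumr_ge0 => i _; rewrite exprn_ge0.
Qed.

Lemma gram_diag_eigenvalue A k :
  eigenvalue (A ^t* *m A) (spectral_diag (A ^t* *m A) ord0 k).
Proof.
set H := A ^t* *m A.
have /hermitian_normalmx/orthomx_spectralP := gram_hermitian A.
rewrite -/H; set P := spectralmx H; set d := spectral_diag H => HE.
have Pu : P \in unitmx by exact: spectral_unit.
apply/eigenvalueP; exists (row k P).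
  rewrite -row_mul [in P *m H]HE !mulmxA mulmxV // mul1mx.
  by apply/rowP => j; rewrite mul_diag_mx !mxE.
apply/eqP => r0; have := mulmxV Pu => /(congr1 (row k)) /eqP.
rewrite row_mul r0 mul0mx => /eqP /rowP /(_ k).
by rewrite !mxE eqxx => /eqP; rewrite eq_sym oner_eq0.
Qed.

Lemma sigma_min_le_singular_value A s : singular_value A s -> sigma_min A <= s.
Proof.
move=> sA; apply: ge_inf => //; exists 0 => r [] //.
Qed.

Lemma sigma_min_ge0 A : 0 <= sigma_min A.
Proof.
rewrite /sigma_min; have [->|/set0P S0] := eqVneq [set s | singular_value A s] set0.
  by rewrite inf0.
by apply: lb_le_inf => // r [].
Qed.

(** Each weight of the spectral decomposition is the square of a singular
    value, hence at least the square of the smallest one. *)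
Lemma sigma_min_sqr_le A z :
  (sigma_min A ^+ 2)%:C * \sum_i `|z i ord0| ^+ 2
    <= \sum_i `|(A *m z) i ord0| ^+ 2.
Proof.
rewrite gram_spectral_decomp.
rewrite -(sum_sqr_norm_unitary z (spectral_unitarymx (A ^t* *m A))) mulr_sumr.
apply: ler_sum => k _; apply: ler_wpM2r; first by rewrite exprn_ge0.
have d0 := gram_diag_ge0 A k; have dE := gram_diag_eigenvalue A k.
move: (spectral_diag _ _ _) d0 dE => d d0 dE.
have dR : d = (complex.Re d)%:C by rewrite RRe_real // ger0_real.
have r0 : 0 <= complex.Re d by move: d0; rewrite dR lecR.
rewrite dR lecR -[leRHS]sqr_sqrtr // lerXn2r ?nnegrE ?sqrtr_ge0 ?sigma_min_ge0 //.
apply: sigma_min_le_singular_value; split; first exact: sqrtr_ge0.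
by rewrite (sqr_sqrtr r0) -dR.
Qed.

(** A single nonzero test vector bounds the smallest singular value from above;
    it is enough to compare entries one by one. *)
Lemma sigma_min_le A z (c : R) : z != 0 -> 0 <= c ->
  (forall i, `|(A *m z) i ord0| <= c%:C * `|z i ord0|) -> sigma_min A <= c.
Proof.
move=> z0 c0 Hz.
have S0 : 0 < \sum_i `|z i ord0| ^+ 2.
  rewrite lt_neqAle sumr_ge0 ?andbT; last by move=> i _; rewrite exprn_ge0.
  apply: contra z0; rewrite eq_sym psumr_eq0; last by move=> i _; rewrite exprn_ge0.
  move=> /allP z0; apply/eqP/matrixP => i j; rewrite ord1 mxE.
  have /implyP/(_ isT) := z0 i (mem_index_enum i).
  by rewrite sqrf_eq0 normr_eq0 => /eqP.
have : (sigma_min A ^+ 2)%:C <= (c ^+ 2)%:C.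
  rewrite -(ler_pM2r S0) (le_trans (sigma_min_sqr_le A z)) //.
  rewrite mulr_sumr; apply: ler_sum => i _.
  by rewrite rmorphXn /= -exprMn lerXn2r ?nnegrE ?mulr_ge0 ?normr_ge0 ?ler0c.
by rewrite lecR ler_pXn2r ?nnegrE ?sigma_min_ge0.
Qed.

End SmallestSingularValue.

(** * Complex numbers in rectangular and polar form *)

Section ComplexArithmetic.
Variable R : realType.
Implicit Types a b : R[i].

Lemma recD a b : complex.Re (a + b) = complex.Re a + complex.Re b.
Proof. by case: a b => ? ? []. Qed.

Lemma imcD a b : complex.Im (a + b) = complex.Im a + complex.Im b.
Proof. by case: a b => ? ? []. Qed.

Lemma recM a b :
  complex.Re (a * b) = complex.Re a * complex.Re b - complex.Im a * complex.Im b.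
Proof. by case: a b => ? ? []. Qed.

Lemma imcM a b :
  complex.Im (a * b) = complex.Re a * complex.Im b + complex.Im a * complex.Re b.
Proof. by case: a b => ? ? []. Qed.

Lemma rec_conj a : complex.Re (conjc a) = complex.Re a.
Proof. by case: a. Qed.

Lemma imc_conj a : complex.Im (conjc a) = - complex.Im a.
Proof. by case: a. Qed.

Lemma rec_sum (I : finType) (P : pred I) (F : I -> R[i]) :
  complex.Re (\sum_(j | P j) F j) = \sum_(j | P j) complex.Re (F j).
Proof. by apply: (big_morph (@complex.Re R)) => // a b; exact: recD. Qed.

Lemma imc_sum (I : finType) (P : pred I) (F : I -> R[i]) :
  complex.Im (\sum_(j | P j) F j) = \sum_(j | P j) complex.Im (F j).
Proof. by apply: (big_morph (@complex.Im R)) => // a b; exact: imcD. Qed.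

Lemma conjcD a b : conjc (a + b) = conjc a + conjc b.
Proof. exact: rmorphD. Qed.

Lemma conjcM a b : conjc (a * b) = conjc a * conjc b.
Proof. exact: rmorphM. Qed.

Lemma conjc_sum (I : finType) (P : pred I) (F : I -> R[i]) :
  conjc (\sum_(j | P j) F j) = \sum_(j | P j) conjc (F j).
Proof. exact: rmorph_sum. Qed.

Lemma rectE (p q : R) : p +i* q = p%:C + 'i * q%:C.
Proof.
by apply/eqP; rewrite eq_complex /=; apply/andP; split; apply/eqP; ring.
Qed.

Lemma conjc_rect (p q : R) : conjc (p%:C + 'i * q%:C) = p%:C - 'i * q%:C.
Proof.
rewrite -rectE.
by apply/eqP; rewrite eq_complex /=; apply/andP; split; apply/eqP; ring.
Qed.

Definition cis (t : R) : R[i] := cos t +i* sin t.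

Lemma cis_conj t : cis t * conjc (cis t) = 1.
Proof.
apply/eqP; rewrite eq_complex /=.
rewrite mulrN opprK -!expr2 cos2Dsin2 eqxx /=.
by rewrite mulrN [sin t * _]mulrC addrC subrr.
Qed.

Lemma cis_neq0 t : cis t != 0.
Proof.
apply/eqP => c0; have := cis_conj t; rewrite c0 mul0r => /eqP.
by rewrite eq_sym oner_eq0.
Qed.

Lemma conj_cis t : conjc (cis t) = (cis t)^-1.
Proof. by apply: (mulfI (cis_neq0 t)); rewrite cis_conj divff ?cis_neq0. Qed.

Lemma norm_cis t : `|cis t| = 1.
Proof. by rewrite normc_def /= cos2Dsin2 sqrtr1. Qed.

End ComplexArithmetic.

(** * Derivatives of complex functions of a real variable *)

Section ComplexDerivative.
Variable R : realType.
Implicit Types (f g : R -> R[i]) (t : R) (df dg : R[i]).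

(** Complex conjugation makes the complex power non-holomorphic, so only real
    differentiability, component by component, is available. *)
Definition is_cderive f t df :=
  is_derive t 1 (fun h => complex.Re (f h)) (complex.Re df) /\
  is_derive t 1 (fun h => complex.Im (f h)) (complex.Im df).

Lemma is_cderive_real (u : R -> R) t du :
  is_derive t 1 u du -> is_cderive (fun h => (u h)%:C) t du%:C.
Proof. by move=> ud; split=> //=; exact: is_derive_cst. Qed.

Lemma is_cderive_cst (c : R[i]) t : is_cderive (fun=> c) t 0.
Proof. by split=> /=; exact: is_derive_cst. Qed.

Lemma is_cderiveD f g t df dg : is_cderive f t df -> is_cderive g t dg ->
  is_cderive (fun h => f h + g h) t (df + dg).
Proof.
move=> [fr fi] [gr gi]; split; under eq_fun do rewrite ?recD ?imcD.
- by rewrite recD; exact: is_deriveD.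
- by rewrite imcD; exact: is_deriveD.
Qed.

Lemma is_cderiveM f g t df dg : is_cderive f t df -> is_cderive g t dg ->
  is_cderive (fun h => f h * g h) t (df * g t + f t * dg).
Proof.
move=> [fr fi] [gr gi]; split; under eq_fun do rewrite ?recM ?imcM.
- apply: is_derive_eq; rewrite recD !recM /GRing.scale /=; ring.
- apply: is_derive_eq; rewrite imcD !imcM /GRing.scale /=; ring.
Qed.

Lemma is_cderive_conj f t df :
  is_cderive f t df -> is_cderive (fun h => conjc (f h)) t (conjc df).
Proof.
move=> [fr fi]; split; under eq_fun do rewrite ?rec_conj ?imc_conj.
- by rewrite rec_conj.
- by rewrite imc_conj; exact: is_deriveN.
Qed.

Lemma is_cderive_sum (N : nat) (F : 'I_N -> R -> R[i]) t (dF : 'I_N -> R[i]) :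
  (forall j, is_cderive (F j) t (dF j)) ->
  is_cderive (fun h => \sum_j F j h) t (\sum_j dF j).
Proof.
move=> FdF; elim: (index_enum _) => [|j s IHs].
  rewrite big_nil (_ : (fun h => _) = fun=> 0); first exact: is_cderive_cst.
  by apply/funext => h; rewrite big_nil.
rewrite big_cons (_ : (fun h => _) = fun h => F j h + \sum_(j <- s) F j h).
  exact: is_cderiveD.
by apply/funext => h; rewrite big_cons.
Qed.

Lemma is_cderive_cis (a : R -> R) t da : is_derive t 1 a da ->
  is_cderive (fun h => cis (a h)) t ('i * da%:C * cis (a t)).
Proof.
move=> ad; split=> /=.
- apply: (is_derive_eq (is_derive1_comp (is_derive_cos (a t)) ad)); ring.
- apply: (is_derive_eq (is_derive1_comp (is_derive_sin (a t)) ad)); ring.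
Qed.

(** Directional derivatives on a normed module reduce to derivatives of
    functions of one real variable, for which the chain rule and the derivatives
    of sine, cosine and powers apply. *)
Lemma derive_along_line (V : normedModType R) (f : V -> R) (a v : V) (df : R) :
  is_derive (0 : R) 1 (fun h => f (h *: v + a)) df -> 'D_v f a = df.
Proof.
move=> [_ <-]; rewrite /derive.
set g1 := fun h => h^-1 *: _; set g2 := fun h => h^-1 *: _.
suff -> : g1 = g2 by [].
apply/funext => h; rewrite /g1 /g2 /= scale0r add0r.
congr (_ *: (f (_ *: _ + _) - _)).
by rewrite addr0; exact/esym/mulr1.
Qed.

End ComplexDerivative.

(** * Power balance and its linearization *)

Section PowerBalance.
Variables (R : realType) (n g : nat) (S : power_system R n g).
Variable phi : 'I_(n + g) -> 'I_(n + g) -> R.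
Hypothesis phiP : phase_shifts S phi.
Variable x : state S.
Implicit Types (y u v : 'rV[R]_(n + n)) (i : 'I_n) (b : 'I_(n + g)).

Definition phasor y b : R[i] := (bus_mag x y b)%:C * cis (bus_angle x y b).

(** The derivative of V e^(j theta) in the direction v. *)
Definition phasor_variation y v : 'cV[R[i]]_n :=
  \col_i (((vm v i)%:C + 'i * (vm y i * th v i)%:C) * cis (th y i)).

Definition dphasor y v b : R[i] :=
  match fintype.split b with
  | inl i => phasor_variation y v i ord0
  (* internal voltages depend on the state, which is held fixed *)
  | inr _ => 0
  end.

Definition power_mismatch y i : R[i] :=
  phasor y (lshift g i)
    * conjc (\sum_b Yaug S (lshift g i) b * phasor y b)
  + (Pstat S i (vm y i) +i* Qstat S i (vm y i))
  + conjc (motor_adm (ld S i) (slip (xm x i))) * (vm y i ^+ 2)%:C.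

Definition dpower_mismatch y v i : R[i] :=
  dphasor y v (lshift g i)
    * conjc (\sum_b Yaug S (lshift g i) b * phasor y b)
  + phasor y (lshift g i)
    * conjc (\sum_b Yaug S (lshift g i) b * dphasor y v b)
  + (expP (ld S i) * Pstat S i (vm y i) / vm y i
     +i* (expQ (ld S i) * Qstat S i (vm y i) / vm y i)) * (vm v i)%:C
  + conjc (motor_adm (ld S i) (slip (xm x i))) * (2 * vm y i * vm v i)%:C.

Lemma split_lshift i : fintype.split (lshift g i) = inl i.
Proof. exact: (unsplitK (inl i)). Qed.

Lemma phasor_lshift y i : phasor y (lshift g i) = (vm y i)%:C * cis (th y i).
Proof. by rewrite /phasor /bus_mag /bus_angle split_lshift. Qed.

(** The phase shift is the angle of the admittance less a quarter turn:
    Ytilde_ib = j |Ytilde_ib| e^(j phi_ib).  This brings the power sent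
    towards bus b to the form in which it enters the power flow equations. *)
Lemma line_power i b y : lshift g i != b ->
  phasor y (lshift g i) * conjc (Yaug S (lshift g i) b * phasor y b) =
  (vm y i * bus_mag x y b * cmod (Yaug S (lshift g i) b))%:C
    * (sin (th y i - bus_angle x y b - phi (lshift g i) b)
       -i* cos (th y i - bus_angle x y b - phi (lshift g i) b)).
Proof.
move=> ib; have [] := phiP ib; rewrite /Baug /Gaug phasor_lshift /phasor.
move: (cmod _) => C; case: (Yaug S (lshift g i) b) => G B /= BE GE _.
rewrite !(sinB, cosB) BE GE.
set a1 := th y i; set a2 := bus_angle x y b; set p := phi _ _.
by apply/eqP; rewrite eq_complex /=; apply/andP; split; apply/eqP; ring.
Qed.

Lemma self_power i y :
  phasor y (lshift g i)
    * conjc (Yaug S (lshift g i) (lshift g i) * phasor y (lshift g i)) =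
  (vm y i ^+ 2)%:C * conjc (Yaug S (lshift g i) (lshift g i)).
Proof.
rewrite phasor_lshift !conjcM conjc_real -[RHS]mulr1 -(cis_conj (th y i)).
by rewrite rmorphXn; ring.
Qed.

(** The two real power flow equations of a bus form one complex equation, whose
    network part is bilinear in the phasors and their conjugates. *)
Lemma power_mismatchE y i :
  g_p phi x y i +i* g_q phi x y i = power_mismatch y i.
Proof.
rewrite /power_mismatch (bigD1 (lshift g i)) //= conjcD mulrDr self_power.
rewrite conjc_sum mulr_sumr.
under eq_bigr => b bi do rewrite line_power 1?eq_sym //.
apply/eqP; rewrite eq_complex /= !(recD, imcD, recM, imcM, rec_sum, imc_sum) /=.
rewrite /g_p /g_q /Pmot /Qmot /Gaug /Baug !rec_conj !imc_conj.
rewrite !(mulr0, mul0r, subr0, addr0, add0r).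
apply/andP; split; apply/eqP.
- congr (_ + _ + _ + _).
  by apply: eq_bigr => b _; rewrite mul0r subr0.
- rewrite mulrN; congr (_ + _ + _ + _).
  rewrite -sumrN; apply: eq_bigr => b _.
  by rewrite mul0r addr0 mulrN.
Qed.

Lemma th_line y v h i : th (h *: v + y) i = h * th v i + th y i.
Proof. by rewrite /th !mxE. Qed.

Lemma vm_line y v h i : vm (h *: v + y) i = h * vm v i + vm y i.
Proof. by rewrite /vm !mxE. Qed.

Lemma is_derive_affine (a c : R) :
  is_derive (0 : R) 1 (fun h : R => h * a + c) a.
Proof. by apply: is_derive_eq; rewrite /GRing.scale /=; ring. Qed.

Lemma is_cderive_phasor y v b :
  is_cderive (fun h => phasor (h *: v + y) b) 0 (dphasor y v b).
Proof.
rewrite /phasor /dphasor /bus_mag /bus_angle.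
case: (fintype.split b) => [i|k]; last exact: is_cderive_cst.
rewrite mxE; under eq_fun do rewrite th_line vm_line.
have := is_cderiveM (is_cderive_real (is_derive_affine (vm v i) (vm y i)))
  (is_cderive_cis (is_derive_affine (th v i) (th y i))).
rewrite !mul0r !add0r; congr is_cderive.
by rewrite rmorphM /=; ring.
Qed.

(** The derivative of p V^a is written a (p V^a) / V, since the bound involves
    the load itself through its equivalent admittance. *)
Lemma is_derive_load (p a V dV : R) : 0 < V ->
  is_derive (0 : R) 1 (fun h : R => p * (h * dV + V) `^ a)
    (a * (p * V `^ a) / V * dV).
Proof.
move=> V0.
have V0' : 0 < 0 * dV + V by rewrite mul0r add0r.
have D := @is_derive1_comp R (fun z => z `^ a) (fun h => h * dV + V) 0 _ _
  (is_derive1_powR a V0') (is_derive_affine dV V).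
have := is_deriveZ p D.
rewrite mul0r add0r => {}D; apply: (is_derive_eq D).
have VE : V `^ (a - 1) = V `^ a / V.
  by rewrite powRB ?(gt_eqF V0) ?implybT // powRr1 ?ltW.
by rewrite VE /GRing.scale /=; ring.
Qed.

Lemma is_cderive_complex (p q : R -> R) (t dp dq : R) :
  is_derive t 1 p dp -> is_derive t 1 q dq ->
  is_cderive (fun h => p h +i* q h) t (dp +i* dq).
Proof. by []. Qed.

Lemma is_cderive_power_mismatch y v i : 0 < vm y i ->
  is_cderive (fun h => power_mismatch (h *: v + y) i) 0 (dpower_mismatch y v i).
Proof.
move=> V0; rewrite /power_mismatch /Pstat /Qstat.
under eq_fun do rewrite vm_line.
have DY : is_cderive (fun h => conjc (\sum_b Yaug S (lshift g i) b
    * phasor (h *: v + y) b)) 0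
    (conjc (\sum_b Yaug S (lshift g i) b * dphasor y v b)).
  apply/is_cderive_conj/is_cderive_sum => b.
  have := is_cderiveM (is_cderive_cst (Yaug S (lshift g i) b) 0)
    (is_cderive_phasor y v b).
  by rewrite mul0r add0r.
have DV := is_derive_affine (vm v i) (vm y i).
have := is_cderiveD (is_cderiveD
  (is_cderiveM (is_cderive_phasor y v (lshift g i)) DY)
  (is_cderive_complex
    (is_derive_load (P0 (ld S i)) (expP (ld S i)) (vm v i) V0)
    (is_derive_load (Q0 (ld S i)) (expQ (ld S i)) (vm v i) V0)))
  (is_cderiveM (is_cderive_cst (conjc (motor_adm (ld S i) (slip (xm x i)))) 0)
    (is_cderiveM (is_cderive_real DV) (is_cderive_real DV))).
rewrite !(mul0r, add0r) !scale0r !add0r.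
under eq_fun do rewrite -rmorphM -expr2.
congr is_cderive.
rewrite /dpower_mismatch /Pstat /Qstat; congr (_ + _ + _ + _ * _).
- by apply/eqP; rewrite eq_complex /= !(mulr0, subr0, add0r) !eqxx.
- by rewrite -!rmorphM -rmorphD /=; congr (_%:C); ring.
Qed.

Lemma dphasor_linear y (a : R) u v b :
  dphasor y (a *: u + v) b = a%:C * dphasor y u b + dphasor y v b.
Proof.
rewrite /dphasor; case: (fintype.split b) => [i|k]; last by rewrite mulr0 addr0.
by rewrite !mxE th_line vm_line !(rmorphD, rmorphM) /=; ring.
Qed.

Lemma dpower_mismatch_linear y (a : R) u v i :
  dpower_mismatch y (a *: u + v) i =
  a%:C * dpower_mismatch y u i + dpower_mismatch y v i.
Proof.
have sumE : \sum_b Yaug S (lshift g i) b * dphasor y (a *: u + v) b =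
    a%:C * (\sum_b Yaug S (lshift g i) b * dphasor y u b)
    + \sum_b Yaug S (lshift g i) b * dphasor y v b.
  rewrite mulr_sumr -big_split /=; apply: eq_bigr => b _.
  by rewrite dphasor_linear; ring.
rewrite /dpower_mismatch dphasor_linear sumE conjcD conjcM conjc_real.
rewrite vm_line !(rmorphD, rmorphM) /=; ring.
Qed.

End PowerBalance.

(** * Impasse points *)

(** The algebra at one bus, in phasor notation: j is the imaginary unit,
    E = e^(j theta) the phase of the voltage, V its magnitude, d and s the
    variations of V and theta, P, Q, a, b the static load and its exponents, and
    I, D, m the conjugates of the injected current, of its variation and of the
    motor admittance; conj E is written E^-1.  The first hypothesis is the power
    balance, the second its linearization.  With w = d/V + j s and
    P + j Q = V^2 (G - j B), eliminating I leaves terms in w and in d/V only, and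
    writing 2 d/V = w + conj w moves all of the motor term and the halves
    a G/2, b B/2 of the load terms onto conj w, which is the left-hand side. *)
Lemma eliminate_currents (F : numFieldType) (j E V d s I D m P Q a b : F) :
  E != 0 -> V != 0 ->
  V * E * I + (P + j * Q) + m * V ^+ 2 = 0 ->
  (d + j * (V * s)) * E * I + V * E * D
    + (a * P / V + j * (b * Q / V)) * d + m * (2 * V * d) = 0 ->
  V * E * (D + (m + 2^-1 * (a * (P / V ^+ 2))
                - j * 2^-1 * (b * (- Q / V ^+ 2)))
               * ((d - j * (V * s)) * E^-1)) =
  V * E^-1 * ((d + j * (V * s)) * E)
    * ((1 - a / 2) * (P / V ^+ 2) - j * ((1 - b / 2) * (- Q / V ^+ 2))).
Proof.
move=> E0 V0 H1 H2.
have IE : I = - (P + j * Q + m * V ^+ 2) / (V * E).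
  apply: (mulfI (mulf_neq0 V0 E0)); rewrite [RHS]mulrC divfK ?mulf_neq0 //.
  by apply/eqP; rewrite -addr_eq0 addrA H1.
have DE : D = - ((d + j * (V * s)) * E * I
    + (a * P / V + j * (b * Q / V)) * d + m * (2 * V * d)) / (V * E).
  apply: (mulfI (mulf_neq0 V0 E0)); rewrite [RHS]mulrC divfK ?mulf_neq0 //.
  by apply/eqP; rewrite -addr_eq0 -H2; apply/eqP; ring.
rewrite DE IE; field.
by rewrite E0 V0.
Qed.

Section ImpassePoint.
Variables (R : realType) (n g : nat) (S : power_system R n g).
Variable phi : 'I_(n + g) -> 'I_(n + g) -> R.
Hypothesis phiP : phase_shifts S phi.
Variables (x : state S) (y : 'rV[R]_(n + n)).
Hypothesis V_gt0 : forall i, 0 < vm y i.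

(** Linearity in the direction allows the columns of the Jacobian, which are
    partial derivatives, to be combined. *)
Lemma dpower_mismatch_partials (v : 'rV[R]_(n + n)) i :
  dpower_mismatch x y v i =
  \sum_l (v ord0 l)%:C * dpower_mismatch x y (delta_mx ord0 l) i.
Proof.
have L0 : dpower_mismatch x y 0 i = 0.
  have := dpower_mismatch_linear x y (-1) 0 0 i.
  by rewrite scaler0 addr0 rmorphN mulN1r addNr.
rewrite {1}[v]row_sum_delta.
rewrite (big_morph (fun u => dpower_mismatch x y u i) (id1 := 0) (op1 := +%R)).
- apply: eq_bigr => l _.
  by rewrite -[in LHS](addr0 (_ *: _)) dpower_mismatch_linear L0 addr0.
- move=> u w; have := dpower_mismatch_linear x y 1 u w i.
  by rewrite scale1r mul1r.
- exact: L0.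
Qed.

Lemma J_alg_active i l : J_alg phi x y (lshift n i) l =
  complex.Re (dpower_mismatch x y (delta_mx ord0 l) i).
Proof.
rewrite mxE.
under eq_fun => z do rewrite /g_alg row_mxEl mxE
  -[g_p _ _ _ _]/(complex.Re (g_p phi x z i +i* g_q phi x z i))
  (power_mismatchE phiP).
apply: derive_along_line.
by have [] := is_cderive_power_mismatch x (delta_mx ord0 l) (V_gt0 i).
Qed.

Lemma J_alg_reactive i l : J_alg phi x y (rshift n i) l =
  complex.Im (dpower_mismatch x y (delta_mx ord0 l) i).
Proof.
rewrite mxE.
under eq_fun => z do rewrite /g_alg row_mxEr mxE
  -[g_q _ _ _ _]/(complex.Im (g_p phi x z i +i* g_q phi x z i))
  (power_mismatchE phiP).
apply: derive_along_line.
by have [] := is_cderive_power_mismatch x (delta_mx ord0 l) (V_gt0 i).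
Qed.

(** A singular Jacobian has a nonzero kernel vector, and the active and reactive
    rows of a bus are the real and imaginary parts of one complex equation. *)
Lemma impasse_direction : \det (J_alg phi x y) = 0 ->
  exists2 u : 'rV[R]_(n + n), u != 0 & forall i, dpower_mismatch x y u i = 0.
Proof.
rewrite -det_tr => /eqP/det0P[u u0 uJ]; exists u => // i.
apply/eqP; rewrite dpower_mismatch_partials eq_complex rec_sum imc_sum /=.
apply/andP; split; apply/eqP.
- have /rowP/(_ (lshift n i)) := uJ; rewrite !mxE => {2}<-.
  apply: eq_bigr => l _; rewrite [in RHS]mxE J_alg_active recM /=.
  by rewrite mul0r subr0.
- have /rowP/(_ (rshift n i)) := uJ; rewrite !mxE => {2}<-.
  apply: eq_bigr => l _; rewrite [in RHS]mxE J_alg_reactive imcM /=.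
  by rewrite mul0r addr0.
Qed.

Lemma dphasor_lshift u i :
  dphasor y u (lshift g i) = phasor_variation y u i ord0.
Proof. by rewrite /dphasor split_lshift. Qed.

Lemma phasor_variation_neq0 u : u != 0 -> phasor_variation y u != 0.
Proof.
apply: contra => /eqP/colP z0; apply/eqP/rowP => l; rewrite mxE.
have E i : vm u i = 0 /\ th u i = 0.
  have := z0 i; rewrite !mxE => /eqP.
  rewrite mulf_eq0 (negPf (cis_neq0 _)) orbF eq_complex /=.
  rewrite !(mul0r, mulr0, mul1r, subr0, addr0, add0r).
  by rewrite mulf_eq0 (gt_eqF (V_gt0 i)) /= => /andP[/eqP -> /eqP ->].
have [i ->|i ->] := split_ordP l.
- by have [] := E i.
- by have [] := E i.
Qed.

Lemma Y1_mulE (z : 'cV[R[i]]_n) i : (Y1 x y *m z) i ord0 =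
  ((Ybus S + Ygen S) *m z) i ord0
  + (motor_adm (ld S i) (slip (xm x i))
     + 2^-1 * ((expP (ld S i))%:C * (Gstat_eq S y i)%:C)
     + (0 +i* 2^-1) * ((expQ (ld S i))%:C * (Bstat_eq S y i)%:C)) * z i ord0.
Proof.
rewrite /Y1 !mulmxDl -!scalemxAl -!mulmxA !mul_diag_mx !mxE.
by ring.
Qed.

(** Fixed internal voltages reduce the augmented admittance matrix to its upper
    left block. *)
Lemma network_current_variation u i :
  \sum_b Yaug S (lshift g i) b * dphasor y u b =
  ((Ybus S + Ygen S) *m phasor_variation y u) i ord0.
Proof.
rewrite big_split_ord /= [X in _ + X]big1 ?addr0; last first.
  by move=> k _; rewrite /dphasor (unsplitK (inr k)) mulr0.
rewrite [RHS]mxE; apply: eq_bigr => j _.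
by rewrite /Yaug block_mxEul dphasor_lshift.
Qed.

(** The moduli of the two sides of (Y1 z)_i = v_i conj(w_i) c_i, with
    z_i = v_i w_i: both phase factors have modulus 1. *)
Lemma Y1_phasor_variation u i :
  power_mismatch x y i = 0 -> dpower_mismatch x y u i = 0 ->
  `|(Y1 x y *m phasor_variation y u) i ord0| =
  `| (1 - expP (ld S i) / 2) * Gstat_eq S y i
     +i* ((1 - expQ (ld S i) / 2) * Bstat_eq S y i) |
  * `|phasor_variation y u i ord0|.
Proof.
move=> Hp; rewrite /dpower_mismatch dphasor_lshift network_current_variation.
move: Hp; rewrite /power_mismatch Y1_mulE phasor_lshift.
rewrite [phasor_variation y u i ord0]mxE /Gstat_eq /Bstat_eq.
set V := vm y i; set s := th u i; set d := vm u i; set E := cis (th y i).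
move: (Pstat S i V) (Qstat S i V) => P Q.
set a := expP _; set b := expQ _; set m := motor_adm _ _.
set D := (_ *m _) i ord0; set I := \sum_b _ => H1 H2.
set z := (d%:C + 'i * (V * s)%:C) * E.
set c := (_ - _) * _ +i* _.
set X := D + _.
have E0 : E != 0 := cis_neq0 _.
have V0 : V%:C != 0 by rewrite eq_complex /= eqxx andbT (gt_eqF (V_gt0 i)).
(* the identity is proved for the conjugate of (Y1 z)_i, since the power balance
   contains the conjugate currents *)
have := @eliminate_currents _ 'i E V%:C d%:C s%:C (conjc I) (conjc D) (conjc m)
  P%:C Q%:C a%:C b%:C E0 V0.
have -> : V%:C * E * conjc I + (P%:C + 'i * Q%:C) + conjc m * V%:C ^+ 2 = 0.
  by rewrite -rectE -rmorphXn; exact: H1.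
have -> : (d%:C + 'i * (V%:C * s%:C)) * E * conjc I + V%:C * E * conjc D
    + (a%:C * P%:C / V%:C + 'i * (b%:C * Q%:C / V%:C)) * d%:C
    + conjc m * (2 * V%:C * d%:C) = 0.
  by rewrite -[RHS]H2 rectE !rmorphM !fmorphV rmorph_nat.
move=> /(_ erefl erefl) key.
have XE : conjc X = conjc D + (conjc m + 2^-1 * (a%:C * (P%:C / V%:C ^+ 2))
    - 'i * 2^-1 * (b%:C * (- Q%:C / V%:C ^+ 2)))
    * ((d%:C - 'i * (V%:C * s%:C)) / E).
  have half : 2^-1 = (2^-1)%:C :> R[i] by rewrite fmorphV rmorph_nat.
  have -> : X = D + (m + (2^-1 * (a * (P / V ^+ 2))
      +i* (2^-1 * (b * (- Q / V ^+ 2))))) * z.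
    by rewrite /X half; congr (_ + _ * _); rewrite -addrA; congr (_ + _);
       apply/eqP; rewrite eq_complex /=; apply/andP; split; apply/eqP; ring.
  rewrite conjcD conjcM conjcD rectE conjc_rect conjcM conjc_rect conj_cis.
  by rewrite !(rmorphM, rmorphN, fmorphV, rmorphXn) rmorph_nat; ring.
have cE : conjc c = (1 - a%:C / 2) * (P%:C / V%:C ^+ 2)
    - 'i * ((1 - b%:C / 2) * (- Q%:C / V%:C ^+ 2)).
  rewrite /c rectE conjc_rect !(rmorphM, rmorphN, rmorphB, rmorph1, fmorphV, rmorphXn).
  by rewrite rmorph_nat; ring.
have {key XE cE} key : V%:C * E * conjc X = V%:C * E^-1 * z * conjc c.
  by rewrite XE cE key /z rmorphM.
have nE : `|E| = 1 := norm_cis _.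
move: (congr1 Num.norm key); rewrite !normrM !normcJ normfV nE invr1 !mulr1.
by rewrite -mulrA => /(mulfI (_ : `|V%:C| != 0)) ->; rewrite ?normr_eq0 // mulrC.
Qed.

End ImpassePoint.

Theorem theorem1 (R : realType) (n g : nat)
  (g_gt0 : (0 < g)%N) (le_gn : (g <= n)%N)
  (S : power_system R n g)
  (eq_reac : forall k : 'I_g, reac_d (gen S k) = reac_q (gen S k))
  (sym_lines : lines_symmetric S)
  (conn : network_connected S)
  (phi : 'I_(n + g) -> 'I_(n + g) -> R)
  (phiP : phase_shifts S phi)
  (T : set R) (x : R -> state S) (y : R -> 'rV[R]_(n + n))
  (traj : trajectory phi le_gn T x y)
  (mag_ge0 : forall t, T t -> forall b : 'I_(n + g), 0 <= bus_mag (x t) (y t) b)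
  (mag_neq0 : forall t, T t -> forall b : 'I_(n + g), bus_mag (x t) (y t) b != 0)
  (t : R) (Tt : T t) :
  impasse_surface phi (x t, y t) ->
  sigma_min (Y1 (x t) (y t)) <= load_bound S (y t).
Proof.
rewrite /impasse_surface /= => detJ.
have V_gt0 i : 0 < vm (y t) i.
  have := mag_neq0 t Tt (lshift g i); have := mag_ge0 t Tt (lshift g i).
  by rewrite /bus_mag split_lshift lt_neqAle eq_sym => -> ->.
have balance i : power_mismatch (x t) (y t) i = 0.
  rewrite -(power_mismatchE phiP).
  have /rowP galg0 := traj_alg traj Tt.
  have := galg0 (lshift n i); have := galg0 (rshift n i).
  by rewrite /g_alg row_mxEl row_mxEr !mxE => -> ->.
have [u u0 du] := impasse_direction phiP V_gt0 detJ.
apply: (sigma_min_le (phasor_variation_neq0 V_gt0 u0)).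
  exact: bigmax_ge_id.
move=> i; rewrite (Y1_phasor_variation V_gt0 (balance i) (du i)).
apply: ler_wpM2r; first exact: normr_ge0.
rewrite lecR; exact: le_bigmax.
Qed.
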